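(* Let $r\geq 2$ be an integer, and let $\mathcal{H}$ be a nonempty regular $r$-uniform hypergraph. Then there exists a spanning subhypergraph $\mathcal{C}\subseteq \mathcal{H}$ such that $1\leq \deg_{\mathcal{C}} v\leq 100\log r$ for all $v\in V(\mathcal{H})$. In other words, $f(r)\leq 100\log r$.
   Context: A hypergraph $\mathcal{H}$ consists of a finite vertex set $V(\mathcal{H})$ and a set $E(\mathcal{H})$ of subsets of $V(\mathcal{H})$, called edges. It is nonempty if it has at least one edge. It is $r$-uniform if every edge has exactly $r$ vertices. The degree $\deg_{\mathcal{H}} v$ of a vertex $v$ is the number of edges containing $v$; $\mathcal{H}$ is $d$-regular if every vertex has degree $d$, and regular if it is $d$-regular for some $d$. A spanning subhypergraph $\mathcal{C}\subseteq\mathcal{H}$ is a hypergraph with $V(\mathcal{C})=V(\mathcal{H})$ and $E(\mathcal{C})\subseteq E(\mathcal{H})$. For $r\geq 2$, $f(r)$ denotes the smallest integer $t$ for which every nonempty regular $r$-uniform hypergraph contains a spanning subhypergraph with all degrees between $1$ and $t$. Here $\log$ is the natural logarithm. *)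

(* Defs.v *)
From mathcomp Require Import all_boot.

Set Implicit Arguments.
Unset Strict Implicit.
Unset Printing Implicit Defensive.

(* A hypergraph on the vertex set V is given by its set of edges; two
   hypergraphs with the same vertex set are thus terms of the same type. *)
Definition hypergraph (V : finType) := {set {set V}}.

Definition nonempty (V : finType) (H : hypergraph V) : Prop := H != set0.

Definition uniform (V : finType) (r : nat) (H : hypergraph V) : Prop :=
  forall e : {set V}, e \in H -> #|e| = r.

Definition deg (V : finType) (H : hypergraph V) (v : V) : nat :=
  #|[set e in H | v \in e]|.

Definition regular (V : finType) (H : hypergraph V) : Prop :=
  exists d : nat, forall v : V, deg H v = d.

Definition spanning_subhypergraph (V : finType) (C H : hypergraph V) : Prop :=
  C \subset H.

Definition degree_bound (r t : nat) : Prop :=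
  forall (V : finType) (H : hypergraph V),
    nonempty H -> regular H -> uniform r H ->
    exists C : hypergraph V,
      spanning_subhypergraph C H /\ forall v : V, 1 <= deg C v <= t.

(* f(r) = t. Ranging over nat rather than int loses nothing: for r >= 1 some
   nonempty regular r-uniform hypergraph has a vertex, which forces t >= 1. *)
Definition is_f (r t : nat) : Prop :=
  degree_bound r t /\ forall s : nat, degree_bound r s -> t <= s.

(* Main.v *)
Require Import Defs.
From mathcomp Require Import all_boot all_order all_algebra.
From mathcomp Require Import lra zify.
From mathcomp Require Import reals sequences exp.
From mathcomp Require boolp.
Import Order.TTheory GRing.Theory Num.Theory.
Local Open Scope ring_scope.

(* If the degree d exceeds 3r, give every edge the weight 3r/d; Beck-Fiala rounding
   turns these weights into 0 or 1 and changes each vertex sum by at most r. In all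
   cases one gets a subhypergraph with all degrees in [D, 2D] for some D <= 3r,
   so that degrees are polynomial in r. Either 2D <= 100 ln r, or one keeps each
   edge independently with probability 10 ln r / D: a vertex is isolated or has
   degree above 100 ln r with probability at most 2 r^-10, while its event depends
   on at most 6 r^2 others, and the Lovasz local lemma applies. *)

(** * Beck-Fiala rounding by linear algebra *)

(** The matrix of [a] has more rows than columns, so its left kernel is nonzero; any nonzero vector
    in it serves as [y]. *)
Lemma linear_relation (K : fieldType) (E T : finType) (a : E -> T -> K) :
  (#|T| < #|E|)%N ->
  exists2 y : E -> K, exists e, y e != 0 & forall t, \sum_e y e * a e t = 0.
Proof.
move=> ltTE.
pose A : 'M[K]_(#|E|, #|T|) := \matrix_(i, j) a (enum_val i) (enum_val j).
have : kermx A != 0.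
  rewrite kermx_eq0 /row_free neq_ltn (leq_ltn_trans _ ltTE) //.
  exact: rank_leq_col.
case/rowV0Pn=> u /sub_kermxP uA0 /rV0Pn[i ui0].
exists (fun e => u 0 (enum_rank e)).
  by exists (enum_val i); rewrite enum_valK.
move=> t; have /rowP/(_ (enum_rank t)) := uA0; rewrite !mxE => uAt.
rewrite -[RHS]uAt (reindex (@enum_val E E)) /=; last first.
  by apply: onW_bij; exact: enum_val_bij.
by apply: eq_bigr => j _; rewrite !mxE enum_valK enum_rankK.
Qed.

(** [tau e] is the largest step along [y] that keeps coordinate [e] in [0, 1]. The least such step
    over the support of [y] is safe for every coordinate and brings its minimiser [e0] to 0 or 1. *)
Lemma move_to_boundary (K : realFieldType) (E : finType) (x y : E -> K) :
  (forall e, 0 <= x e <= 1) ->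
  (forall e, y e != 0 -> 0 < x e < 1) ->
  (exists e, y e != 0) ->
  exists t : K, (forall e, 0 <= x e + t * y e <= 1) /\
    exists2 e, 0 < x e < 1 & ~~ (0 < x e + t * y e < 1).
Proof.
move=> x01 suppy [e1 ye1].
pose tau e := if 0 < y e then (1 - x e) / y e else x e / - y e.
case: (@arg_minP _ _ _ e1 (fun e => y e != 0) tau ye1) => e0 ye0 mintau.
have tau_ge0 e : 0 <= tau e.
  have /andP[x0 x1] := x01 e; rewrite /tau; case: ltP => y0.
    by rewrite divr_ge0 ?subr_ge0 // ltW.
  by rewrite divr_ge0 // oppr_ge0.
exists (tau e0); split=> [e|].
  have /andP[x0 x1] := x01 e; have t0 := tau_ge0 e0.
  have [->|ye] := eqVneq (y e) 0; first by rewrite mulr0 addr0 x0.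
  have := mintau e ye; rewrite /tau -/(tau e0); case: ifPn => [y0|].
    rewrite ler_pdivlMr // => le.
    have := mulr_ge0 t0 (ltW y0); lra.
  rewrite -leNgt le_eqVlt (negbTE ye) /= => y0.
  have Ny0 : 0 < - y e by rewrite oppr_gt0.
  rewrite ler_pdivlMr // => le.
  have := mulr_ge0 t0 (ltW Ny0); lra.
exists e0; first exact: suppy.
rewrite /tau; case: ifPn => _.
  by rewrite divfK // addrC subrK ltxx andbF.
by rewrite invrN mulrN mulNr divfK // subrr ltxx.
Qed.

(* Beck-Fiala: call [v] live when it lies in more than [r] of the sets [inc e]
   with [x e] fractional. There are fewer live [v] than fractional [e], so one can
   move [x] along a linear relation that preserves every live sum until a new
   coordinate becomes integral; a [v] that is not live changes by at most [r] in
   all remaining steps together. *)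
Lemma round_fractional (K : realFieldType) (E V : finType)
    (inc : E -> {set V}) (r : nat) (x : E -> K) :
  (forall e, 0 <= x e <= 1) ->
  (forall e, 0 < x e < 1 -> (#|inc e| <= r)%N) ->
  exists2 z : E -> bool,
    forall e, ~~ (0 < x e < 1) -> (z e)%:R = x e &
    forall v, `|\sum_(e | v \in inc e) (z e)%:R - \sum_(e | v \in inc e) x e|
              <= r%:R.
Proof.
pose fl (x : E -> K) := [set e | 0 < x e < 1].
have [n] := ubnP #|fl x|; elim: n x => // n IHn x lexn x01 inc_r.
have xint e : ~~ (0 < x e < 1) -> ((x e == 1)%:R : K) = x e.
  have /andP[x0 x1] := x01 e.
  rewrite negb_and -!leNgt => /orP[le0|le1].
    have -> : x e = 0 by apply/le_anti; rewrite le0.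
    by rewrite eq_sym oner_eq0.
  have -> : x e = 1 by apply/le_anti; rewrite le1 x1.
  by rewrite eqxx.
have [fl0|[e1 fle1]] := set_0Vmem (fl x).
  have nofl e : ~~ (0 < x e < 1).
    by apply/negP => h; have : e \in fl x by [rewrite inE]; rewrite fl0 inE.
  exists (fun e => x e == 1) => [e|v]; first exact: xint.
  by rewrite (eq_bigr _ (fun e _ => xint e (nofl e))) subrr normr0 ler0n.
pose live := [set v | (r < #|[set e in fl x | v \in inc e]|)%N].
have lt_live : (#|live| < #|fl x|)%N.
  (* Double counting of incidences: each fractional [e] covers at most [r] points, while each live
     [v] lies in at least [r.+1] fractional sets. *)
  have cnt : (\sum_v #|[set e in fl x | v \in inc e]| <= #|fl x| * r)%N.
    under eq_bigr do rewrite -sum1_card.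
    rewrite (exchange_big_dep (mem (fl x))) /=; last first.
      by move=> v e _; rewrite inE => /andP[].
    rewrite -sum_nat_const; apply: leq_sum => e fle.
    rewrite sum1_card; apply: leq_trans (inc_r e _); last by rewrite inE in fle.
    apply/subset_leq_card/subsetP => v h.
    by have : e \in [set e in fl x | v \in inc e] := h; rewrite inE => /andP[].
  have cnt2 : (#|live| * r.+1 <= #|fl x| * r)%N.
    apply: leq_trans cnt; rewrite -sum_nat_const.
    rewrite [leqRHS](bigID (mem live)) /=; apply: leq_trans (leq_addr _ _).
    by apply: leq_sum => v; rewrite inE.
  rewrite ltnNge; apply/negP => le.
  have : (#|fl x| * r.+1 <= #|fl x| * r)%N.
    by apply: leq_trans cnt2; rewrite leq_mul2r le orbT.
  rewrite leq_mul2l ltnn orbF cards_eq0 => /eqP f0.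
  by rewrite f0 inE in fle1.
(* One equation per live [v], preserving its sum, and one per integral [e'], forcing [y e' = 0]:
   fewer than [#|E|] in all. *)
pose T := ({v | v \in live} + {e | e \notin fl x})%type.
pose a e (t : T) : K := match t with
  | inl v => (val v \in inc e)%:R | inr e' => (e == val e')%:R end.
have ltTE : (#|{: T}| < #|E|)%N.
  rewrite card_sum !card_sig.
  have -> : #|[pred e | e \notin fl x]| = #|~: fl x|.
    by apply: eq_card => e; rewrite !inE.
  by rewrite -[ltnRHS](cardsC (fl x)) ltn_add2r.
have [y ynz yrel] := linear_relation K E T a ltTE.
have suppy e : y e != 0 -> 0 < x e < 1.
  apply: contraR => nfl.
  have nfl' : e \notin fl x by rewrite inE.
  have := yrel (inr (exist _ e nfl')); rewrite (bigD1 e) //= eqxx mulr1.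
  rewrite big1 ?addr0 => [->//|e' ne].
  by rewrite (negbTE ne) mulr0.
have ylive v : v \in live -> \sum_(e | v \in inc e) y e = 0.
  move=> lv; have := yrel (inl (exist _ v lv)); rewrite /= => rel.
  rewrite -[RHS]rel big_mkcond; apply: eq_bigr => e _.
  by case: (v \in inc e); rewrite ?mulr1 ?mulr0.
have [t [x'01 [e0 fle0 nfle0]]] := move_to_boundary K E x y x01 suppy ynz.
pose x' e := x e + t * y e.
have x'x e : ~~ (0 < x e < 1) -> x' e = x e.
  move=> nfl; have /eqP y0 : y e == 0 by apply: contraR nfl => /suppy.
  by rewrite /x' y0 mulr0 addr0.
have flx' e : 0 < x' e < 1 -> 0 < x e < 1.
  by move=> h; apply: contraLR (h) => /[dup] /x'x ->.
have lt_fl : (#|fl x'| < #|fl x|)%N.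
  apply/proper_card/properP; split; last by exists e0; rewrite inE.
  by apply/subsetP => e; rewrite !inE; exact: flx'.
have [|z zx' zsum] := IHn x' (leq_trans lt_fl lexn) x'01.
  by move=> e /flx'; exact: inc_r.
have zx e : ~~ (0 < x e < 1) -> (z e)%:R = x e.
  by move=> nfl; rewrite zx' ?x'x.
exists z => // v; case: (boolP (v \in live)) => lv.
  have := zsum v; rewrite /x' big_split /= -mulr_sumr ylive //.
  by rewrite mulr0 addr0.
(* If [v] is not live, at most [r] fractional coordinates contribute to its sum, and each moves by
   at most 1. *)
rewrite -sumrB; apply: le_trans (ler_norm_sum _ _ _) _.
rewrite inE -leqNgt in lv.
apply: le_trans (_ : (\sum_(e in [set e in fl x | v \in inc e]) 1 : K) <= _).
  rewrite (bigID (mem (fl x))) /= addrC big1 ?add0r.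
    rewrite (eq_bigl (mem [set e in fl x | v \in inc e])); last first.
      by move=> e; rewrite !inE andbC.
    apply: ler_sum => e _; have /andP[x0 x1] := x01 e.
    by rewrite ler_norml; case: (z e) => /=; apply/andP; split; lra.
  by move=> e /andP[_]; rewrite inE => /zx ->; rewrite subrr normr0.
by rewrite sumr_const ler_nat.
Qed.

(** * Independent random subsets *)

(* Weight of [S] when each [e] is picked independently with probability [p e]. *)
Definition weight {K : pzRingType} {E : finType} (p : E -> K) (S : {set E}) : K :=
  \prod_e (if e \in S then p e else 1 - p e).

Definition Pr {K : pzRingType} {E : finType} (p : E -> K) (A : pred {set E}) : K :=
  \sum_(S | A S) weight p S.

Definition depends_on {E : finType} (F : {set E}) (A : pred {set E}) : Prop :=
  forall S T : {set E}, S :&: F = T :&: F -> A S = A T.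

(** By independence, the expectation of a product with one factor per element factorises. *)
Lemma sum_weight_prod (K : comPzRingType) (E : finType) (p a b : E -> K) :
  \sum_S weight p S * \prod_e (if e \in S then a e else b e)
  = \prod_e (p e * a e + (1 - p e) * b e).
Proof.
rewrite bigA_distr /=; apply: eq_bigr => S _.
by rewrite -big_split /=; apply: eq_bigr => e _; case: (e \in S).
Qed.

Lemma sum_weight (K : comPzRingType) (E : finType) (p : E -> K) :
  \sum_S weight p S = 1.
Proof.
rewrite /weight -(bigA_distr 1) /=.
by apply: big1 => e _; rewrite addrC subrK.
Qed.

(* Exchanging the parts of [S] and [T] inside [F] preserves
   [weight p S * weight p T]. *)
Lemma Pr_indep (K : comPzRingType) (E : finType) (p : E -> K) (F : {set E})
    (A B : pred {set E}) :
  depends_on F A -> depends_on (~: F) B ->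
  Pr p [pred S | A S && B S] = Pr p A * Pr p B.
Proof.
move=> dA dB.
pose mix (S T : {set E}) := (S :&: F) :|: (T :\: F).
pose swap (u : {set E} * {set E}) := (mix u.1 u.2, mix u.2 u.1).
have inmix S T e : (e \in mix S T) = if e \in F then e \in S else e \in T.
  by rewrite !inE; case: (e \in F); rewrite /= ?andbT ?andbF ?orbF.
have swapK : involutive swap.
  case=> S T; congr pair; apply/setP => e; rewrite !inmix /=;
  by case: (e \in F).
have wswap u : weight p (swap u).1 * weight p (swap u).2
    = weight p u.1 * weight p u.2.
  rewrite /weight -!big_split /=; apply: eq_bigr => e _.
  by rewrite !inmix; case: (e \in F); rewrite // mulrC.
rewrite /Pr [RHS]mulr_suml; under [RHS]eq_bigr do rewrite mulr_sumr.
rewrite pair_big /= (reindex_inj (inv_inj swapK)) /=.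
(* An unconstrained second set has total weight 1, so the left side is a double sum as well. *)
transitivity (\sum_(u : {set E} * {set E} | (A u.1 && B u.1) && true)
                weight p u.1 * weight p u.2).
  rewrite -(pair_big (fun S => A S && B S) xpredT
              (fun S T => weight p S * weight p T)) /=.
  by apply: eq_bigr => S _; rewrite -mulr_sumr sum_weight mulr1.
apply: eq_big => [[S T]|u _] /=; last exact: esym (wswap u).
rewrite andbT (dA S (mix S T)) ?(dB S (mix T S)) //; apply/setP => e;
by rewrite inE [RHS]inE inmix ?inE; case: (e \in F); rewrite ?andbF.
Qed.

Lemma weight_ge0 (K : realFieldType) (E : finType) (p : E -> K) (S : {set E}) :
  (forall e, 0 <= p e <= 1) -> 0 <= weight p S.
Proof.
move=> p01; apply: prodr_ge0 => e _.
by have /andP[p0 p1] := p01 e; case: ifP; rewrite ?subr_ge0.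
Qed.

Lemma Pr_le (K : realFieldType) (E : finType) (p : E -> K)
    (A B : pred {set E}) :
  (forall e, 0 <= p e <= 1) -> (forall S, A S -> B S) -> Pr p A <= Pr p B.
Proof.
move=> p01 AB; rewrite /Pr [leRHS](bigID A) /=.
rewrite (eq_bigl A) ?lerDl ?sumr_ge0 // => [S _|S]; first exact: weight_ge0.
by case: (boolP (A S)) => [/AB ->|]; rewrite ?andbF.
Qed.

(** * The symmetric Lovász local lemma *)

Section LocalLemma.
Variables (K : realFieldType) (E V : finType) (p : E -> K).
Variables (A : V -> pred {set E}) (F : V -> {set E}).
Hypothesis p01 : forall e, 0 <= p e <= 1.
Hypothesis A_dep : forall v, depends_on (F v) (A v).

Definition avoids (U : {set V}) : pred {set E} :=
  fun S => [forall u in U, ~~ A u S].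

(** This contains [v] itself as soon as [F v] is nonempty, so a bound on its size counts [v] too. *)
Definition neighbours (v : V) : {set V} := [set u | ~~ [disjoint F u & F v]].

Lemma Pr_avoidsU1 (v : V) (U : {set V}) :
  Pr p (avoids (v |: U)) = Pr p (avoids U) - Pr p [pred S | A v S && avoids U S].
Proof.
apply/eqP; rewrite eq_sym subr_eq eq_sym; apply/eqP.
rewrite /Pr [RHS](bigID (A v)) /= addrC.
congr (_ + _); apply: eq_bigl => S /=; last by rewrite andbC.
apply/forall_inP/andP => [h|[/forall_inP h Av] u].
  split; last by apply: h; rewrite setU11.
  by apply/forall_inP => u uU; apply: h; rewrite setU1r.
by rewrite in_setU1 => /predU1P[->//|/h].
Qed.

(** Union bound: a set that avoids [U2] but not [U1 :|: U2] lies in some [A u] with [u] in [U1]. *)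
Lemma Pr_avoidsU_ge (U1 U2 : {set V}) (x : K) :
  (forall u, u \in U1 -> Pr p [pred S | A u S && avoids U2 S] <= x) ->
  Pr p (avoids U2) - #|U1|%:R * x <= Pr p (avoids (U1 :|: U2)).
Proof.
move=> hx; rewrite lerBlDr.
apply: le_trans (_ : _ <= Pr p (avoids (U1 :|: U2)) +
    \sum_(u in U1) Pr p [pred S | A u S && avoids U2 S]) _; last first.
  rewrite lerD2l; apply: le_trans (ler_sum _ hx) _.
  by rewrite sumr_const mulr_natl.
rewrite /Pr (exchange_big_dep (avoids U2)) /=; last by move=> u S _ /andP[].
rewrite (bigID (avoids (U1 :|: U2))) /=; apply: lerD.
  apply: (Pr_le _ _ p (fun S => avoids U2 S && avoids (U1 :|: U2) S)) => // S.
  by case/andP.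
rewrite big_mkcondr /=; apply: ler_sum => S aS.
case: ifPn => [|_].
  rewrite negb_forall_in => /exists_inP[u]; rewrite in_setU negbK.
  case/orP=> [uU1|uU2] AuS; last by have /forall_inP/(_ u uU2) := aS; rewrite AuS.
  rewrite (bigD1 u) /= ?uU1 ?AuS //= lerDl.
  by apply: sumr_ge0 => ? _; exact: weight_ge0.
by apply: sumr_ge0 => ? _; exact: weight_ge0.
Qed.

Variables (n : nat) (q : K).
Hypothesis n_gt0 : (0 < n)%N.
Hypothesis deg_n : forall v, (#|neighbours v| <= n)%N.
Hypothesis Aq : forall v, Pr p (A v) <= q.
Hypothesis q_small : 4 * n%:R * q <= 1.

Lemma Pr_avoids_ge0 (U : {set V}) : 0 <= Pr p (avoids U).
Proof. by apply: sumr_ge0 => ? _; exact: weight_ge0. Qed.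

(** Says that [A v] has conditional probability at most 1/(2n) given [avoids U], without dividing by
    a probability that might vanish. Induction on [#|U|]: [A v] is independent of avoiding the
    non-neighbours [U2], and by induction the at most [n] neighbours in [U1] cost at most half of
    [Pr p (avoids U2)]. The bound becomes [2 * q], which is at most 1/(2n). *)
Lemma Pr_bad_avoids (U : {set V}) (v : V) :
  Pr p [pred S | A v S && avoids U S] <= (n.*2%:R)^-1 * Pr p (avoids U).
Proof.
have n0 : 0 < n%:R :> K by rewrite ltr0n.
have q2 : 2 * q <= (n.*2%:R)^-1.
  rewrite -(ler_pM2r n0) -muln2 natrM invfM [leRHS]mulrAC mulVf ?lt0r_neq0 // mul1r.
  by have := q_small; lra.
have [k] := ubnP #|U|; elim: k U v => // k IHk U v leUk.
pose U1 := U :&: neighbours v; pose U2 := U :\: neighbours v.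
have indep : Pr p [pred S | A v S && avoids U2 S] = Pr p (A v) * Pr p (avoids U2).
  apply: (Pr_indep _ _ _ (F v)) => // S T eST.
  apply: eq_forallb_in => u; rewrite !inE negbK => /andP[dis _].
  congr (~~ _); apply: A_dep; apply/setP => e.
  have [eF|] := boolP (e \in F u); last first.
    by rewrite !inE => /negbTE ->; rewrite !andbF.
  have eFv : e \notin F v by rewrite (disjointFr dis eF).
  by have /setP/(_ e) := eST; rewrite !inE eFv eF !andbT.
apply: le_trans (_ : Pr p (A v) * Pr p (avoids U2) <= _).
  rewrite -indep; apply: Pr_le => // S /andP[/= -> /forall_inP h].
  by apply/forall_inP => u /setDP[uU _]; exact: h.
have U12 : U1 :|: U2 = U by rewrite setID.
have half : Pr p (avoids U2) <= 2 * Pr p (avoids U).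
  have P2 := Pr_avoids_ge0 U2; have PU := Pr_avoids_ge0 U.
  (* The induction hypothesis needs [U2] smaller than [U]; otherwise [U1] is empty and [U2 = U]. *)
  have [U10|[u uU1]] := set_0Vmem U1.
    have <- : U2 = U by rewrite -U12 U10 set0U.
    lra.
  have ltU2 : (#|U2| < k)%N.
    rewrite ltnS in leUk; apply: leq_trans leUk.
    rewrite -(cardsID (neighbours v) U) -[ltnLHS]add0n ltn_add2r card_gt0.
    by apply/set0Pn; exists u.
  have := Pr_avoidsU_ge U1 U2 _ (fun u _ => IHk U2 u ltU2); rewrite U12.
  have : #|U1|%:R * ((n.*2)%:R^-1 * Pr p (avoids U2)) <=
         2^-1 * Pr p (avoids U2).
    rewrite mulrA ler_wpM2r // ler_pdivrMr ?ltr0n ?double_gt0 //.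
    rewrite -muln2 natrM mulrC mulfK ?pnatr_eq0 // ler_nat.
    apply: leq_trans (deg_n v).
    exact/subset_leq_card/subsetIr.
  lra.
have PU := Pr_avoids_ge0 U; have PA : 0 <= Pr p (A v).
  by apply: sumr_ge0 => ? _; exact: weight_ge0.
apply: le_trans (ler_wpM2l PA half) _.
rewrite mulrA ler_wpM2r //; apply: le_trans q2.
by rewrite mulrC ler_wpM2l.
Qed.

(** Adding the events one at a time, each keeps at least a fraction 1 - 1/(2n) > 0 of the
    probability. Nonzero weight is recorded because it excludes elements of probability 0 from
    [S]. *)
Lemma local_lemma : exists2 S, weight p S != 0 & forall v, ~~ A v S.
Proof.
have pos (s : seq V) : 0 < Pr p (avoids [set x in s]).
  elim: s => [|v s IHs].
    rewrite /Pr (eq_bigl xpredT) ?sum_weight // => S.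
    by apply/forall_inP => u; rewrite inE.
  rewrite set_cons Pr_avoidsU1 subr_gt0.
  apply: le_lt_trans (Pr_bad_avoids _ _) _.
  rewrite gtr_pMl // invf_lt1 ?ltr1n ?ltr0n ?double_gt0 //.
  by case: (n) n_gt0.
have := pos (enum V); rewrite lt_def => /andP[nz _].
have [S aS wS] : exists2 S, avoids [set x in enum V] S & weight p S != 0.
  apply/exists_inP; apply: contraR nz; rewrite negb_exists_in => /forall_inP h.
  by rewrite /Pr big1 // => S /h; rewrite negbK => /eqP.
exists S => // v; have /forall_inP := aS; apply.
by rewrite inE mem_enum.
Qed.

End LocalLemma.

(** * Reduction to degrees linear in [r] *)

(** If [d <= 3 * r], take [H] itself with [D = d]. Otherwise vertex sums equal to [3 * r] are
    rounded with error at most [r], giving degrees in [2r, 4r] and [D = r.*2]. *)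
Lemma nearly_regular_subhypergraph (V : finType) (H : hypergraph V) (r : nat) :
  (0 < r)%N -> nonempty H -> regular H -> uniform r H ->
  exists (H' : hypergraph V) (D : nat),
    [/\ H' \subset H, (0 < D <= 3 * r)%N & forall v, (D <= deg H' v <= D.*2)%N].
Proof.
move=> r0 /set0Pn[e0 He0] [d dH] unif.
have d0 : (0 < d)%N.
  have : (0 < #|e0|)%N by rewrite unif.
  case/card_gt0P => v ve; rewrite -(dH v); apply/card_gt0P; exists e0.
  by rewrite inE He0.
have [led|ltd] := leqP d (3 * r).
  by exists H, d; split=> [//||v]; rewrite ?d0 // dH leqnn -addnn leq_addr.
pose x (e : {set V}) : rat := if e \in H then (3 * r)%:R / d%:R else 0.
have d0' : 0 < d%:R :> rat by rewrite ltr0n.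
have x01 e : 0 <= x e <= 1.
  rewrite /x; case: ifP => _; last by rewrite lexx ler01.
  by rewrite divr_ge0 ?ler0n //= ler_pdivrMr // mul1r ler_nat ltnW.
have [|z zx zsum] := round_fractional rat {set V} V id r x x01.
  by move=> e; rewrite /x; case: ifP => [/unif->//|]; rewrite ltxx.
have zH e : z e -> e \in H.
  move=> ze; have := zx e; rewrite /x; case: ifP => // _.
  by rewrite ltxx ze => /(_ isT) /eqP; rewrite oner_eq0.
exists [set e | z e], r.*2; split=> [||v].
- by apply/subsetP => e; rewrite inE; exact: zH.
- by rewrite double_gt0 r0 -mul2n leq_mul2r orbT.
have xsum : \sum_(e : {set V} | v \in e) x e = (3 * r)%:R.
  rewrite /x -big_mkcondr /= (eq_bigl (mem [set e in H | v \in e])).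
    by rewrite sumr_const -/(deg H v) dH -(mulr_natr (_ / _)) divfK // lt0r_neq0.
  by move=> e; rewrite !inE andbC.
have zdeg : \sum_(e : {set V} | v \in e) (z e)%:R = (deg [set e | z e] v)%:R :> rat.
  rewrite /deg -sum1_card natr_sum [RHS]big_mkcond [LHS]big_mkcond /=.
  by apply: eq_bigr => e _; rewrite !inE; case: (v \in e); case: (z e).
have := zsum v; rewrite xsum zdeg ler_norml natrM => /andP[h1 h2].
rewrite -!(ler_nat rat) -!muln2 !natrM.
by apply/andP; split; lra.
Qed.

(** * Tail bounds for the degrees of a random subhypergraph *)

Lemma expR_half_le2 (R : realType) : expR (2^-1 : R) <= 2.
Proof.
have := expR_ge1Dx (- 2^-1 : R); rewrite expRN => h.
rewrite -[leLHS]invrK -[leRHS]invrK lef_pV2 ?posrE ?invr_gt0 ?expR_gt0 //.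
by apply: le_trans h; lra.
Qed.

Section Sparsify.
Variables (R : realType) (E : finType) (F H : {set E}) (p : R).
Hypothesis p01 : 0 <= p <= 1.
Hypothesis FH : F \subset H.

Definition pick_in (e : E) : R := if e \in H then p else 0.

Lemma pick_in01 e : 0 <= pick_in e <= 1.
Proof. by rewrite /pick_in; case: ifP => // _; rewrite lexx ler01. Qed.

(** Generating function of the binomial variable [#|F :&: S|]. Taking [b = 1], the value [a = 0]
    handles isolation and [a = expR 2^-1] handles crowding. *)
Lemma pick_in_moment (a b : R) :
  \sum_S weight pick_in S * (a ^+ #|F :&: S| * b ^+ #|F :\: S|)
  = (p * a + (1 - p) * b) ^+ #|F|.
Proof.
pose a' e := if e \in F then a else 1; pose b' e := if e \in F then b else 1.
transitivity (\sum_S weight pick_in S * \prod_e (if e \in S then a' e else b' e)).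
  apply: eq_bigr => S _; congr (_ * _).
  rewrite -!prodr_const big_mkcond [X in _ * X]big_mkcond -big_split /=.
  apply: eq_bigr => e _; rewrite !inE /a' /b'.
  by case: (e \in S); case: (e \in F); rewrite ?mulr1 ?mul1r.
rewrite sum_weight_prod -prodr_const [RHS]big_mkcond.
apply: eq_bigr => e _; rewrite /a' /b' /pick_in; case: (boolP (e \in F)) => [eF|_].
  by rewrite (subsetP FH e eF).
by rewrite !mulr1 addrC subrK.
Qed.

(** Markov's inequality, with [g] dominating the indicator of [A]. *)
Lemma Pr_le_moment (A : pred {set E}) (g : {set E} -> R) :
  (forall S, 0 <= g S) -> (forall S, A S -> 1 <= g S) ->
  Pr pick_in A <= \sum_S weight pick_in S * g S.
Proof.
move=> g0 g1; rewrite [leRHS](bigID A) /= -[leLHS]addr0.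
have w0 S := weight_ge0 _ _ pick_in S pick_in01.
apply: lerD; last by apply: sumr_ge0 => S _; rewrite mulr_ge0.
apply: ler_sum => S /g1 gS; rewrite -[leLHS]mulr1.
exact: ler_wpM2l (w0 S) _ _ gS.
Qed.

Lemma Pr_isolated : Pr pick_in [pred S | F :&: S == set0] <= expR (- (p * #|F|%:R)).
Proof.
have /andP[p0 p1] := p01.
apply: le_trans (_ : _ <= (p * 0 + (1 - p) * 1) ^+ #|F|) _.
  rewrite -pick_in_moment; apply: Pr_le_moment => S /=.
    by rewrite mulr_ge0 ?exprn_ge0.
  by move/eqP=> ->; rewrite cards0 expr0 expr1n mulr1.
rewrite mulr0 add0r mulr1 -mulNr expRM_natr.
by rewrite lerXn2r ?nnegrE ?subr_ge0 ?expR_ge0 // expR_ge1Dx.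
Qed.

(** Chernoff bound with exponential parameter 1/2: since [expR 2^-1 <= 2], each factor of the moment
    is at most 1 + p, hence at most [expR p]. *)
Lemma Pr_crowded (t : R) :
  Pr pick_in [pred S : {set E} | t < #|F :&: S|%:R] <= expR (p * #|F|%:R - t / 2).
Proof.
have /andP[p0 p1] := p01; pose s : R := expR 2^-1.
rewrite addrC expRD.
apply: le_trans (_ : _ <= expR (- (t / 2)) * (p * s + (1 - p) * 1) ^+ #|F|) _.
  rewrite -pick_in_moment mulr_sumr.
  apply: le_trans (Pr_le_moment _
      (fun S => expR (- (t / 2)) * (s ^+ #|F :&: S| * 1 ^+ #|F :\: S|)) _ _) _.
  - by move=> S; rewrite !mulr_ge0 ?expR_ge0 ?exprn_ge0 ?expR_ge0.
  - move=> S /= lt; rewrite expr1n mulr1 -expRM_natr -expRD.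
    rewrite -[leLHS]expR0 ler_expR; lra.
  - by apply: ler_sum => S _; rewrite mulrCA.
rewrite ler_wpM2l ?expR_ge0 // expRM_natr.
have s0 : 0 <= s by exact: expR_ge0.
have s2 : s <= 2 by exact: expR_half_le2.
have ps0 : 0 <= p * s by rewrite mulr_ge0.
have ps2 : p * s <= p * 2 by rewrite ler_wpM2l.
rewrite lerXn2r ?nnegrE ?expR_ge0 //; first by lra.
by apply: le_trans (expR_ge1Dx p); lra.
Qed.

End Sparsify.

(** * Random sparsification and the bound on f(r) *)

Lemma log_degree_subhypergraph (R : realType) (r : nat) (V : finType)
    (H : hypergraph V) :
  (2 <= r)%N -> nonempty H -> regular H -> uniform r H ->
  exists C : hypergraph V, spanning_subhypergraph C H /\
    forall v : V, (1 <= deg C v)%N /\ (deg C v)%:R <= 100 * ln (r%:R : R).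
Proof.
move=> r2 nH regH uH; have r0 : (0 < r)%N := ltnW r2.
have [H' [D [sH /andP[D0 Dr] degH']]] :=
  nearly_regular_subhypergraph V H r r0 nH regH uH.
set L : R := ln r%:R.
have rR0 : 0 < r%:R :> R by rewrite ltr0n.
have expL : expR L = r%:R by rewrite lnK.
have L0 : 0 < L by rewrite ln_gt0 // ltr1n.
have DR0 : 0 < D%:R :> R by rewrite ltr0n.
have [small|large] := leP (D.*2%:R) (100 * L).
  exists H'; split=> // v; have /andP[l u] := degH' v; split.
    exact: leq_trans l.
  by apply: le_trans small; rewrite ler_nat.
(* Expected degrees lie between 10 L and 20 L; [large] makes [p] less than 1. *)
pose p : R := 10 * L / D%:R.
have pD : p * D%:R = 10 * L by rewrite divfK // lt0r_neq0.
have p01 : 0 <= p <= 1.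
  rewrite /p divr_ge0 ?mulr_ge0 ?ler0n ?(ltW L0) //= ler_pdivrMr // mul1r.
  by move: large; rewrite -muln2 natrM; lra.
pose F v := [set e in H' | v \in e].
pose A v : pred {set {set V}} :=
  fun S => (F v :&: S == set0) || (100 * L < #|F v :&: S|%:R).
(* At most 2D edges of [H'] pass through [v], each with [r] vertices, so at most 2Dr events meet
   that of [v]. The two tails give q = 2 r^-10. *)
have [|||||S wS AS] := @local_lemma R {set V} V (pick_in R {set V} H' p) A F
    (pick_in01 _ _ _ _ p01) _ (D.*2 * r) (2 * (r%:R ^+ 10)^-1).
- by move=> v S T; rewrite ![_ :&: F v]setIC /A => ->.
- by rewrite muln_gt0 double_gt0 D0.
- move=> v; apply: leq_trans (_ : #|\bigcup_(e in F v) e| <= _)%N.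
    apply/subset_leq_card/subsetP => u; rewrite inE -setI_eq0 => /set0Pn[e].
    rewrite inE => /andP[eu ev]; apply/bigcupP; exists e => //.
    by move: eu; rewrite inE => /andP[].
  apply: leq_trans (_ : \sum_(e in F v) #|e| <= _)%N.
    elim/big_rec2: _ => [|e m s _ le]; first by rewrite cards0.
    by apply: leq_trans (leq_card_setU _ _) _; rewrite leq_add2l.
  rewrite (eq_bigr (fun=> r)); last first.
    by move=> e; rewrite inE => /andP[/(subsetP sH) /uH].
  by rewrite sum_nat_const leq_mul2r; have /andP[_ ->] := degH' v; rewrite orbT.
- move=> v; have FH : F v \subset H' by apply/subsetP => e; rewrite inE => /andP[].
  have /andP[lF uF] := degH' v.
  have r10 : (r%:R ^+ 10)^-1 = expR (- (10 * L)) by rewrite expRN expRM_natl expL.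
  have lF' : D%:R <= #|F v|%:R :> R by rewrite ler_nat.
  have uF' : #|F v|%:R <= 2 * D%:R :> R.
    by rewrite -natrM ler_nat mul2n.
  have /andP[p0 p1] := p01.
  have pl := ler_wpM2l p0 lF'; have pu := ler_wpM2l p0 uF'.
  have P1 := Pr_isolated R _ (F v) H' p p01 FH.
  have P2 := Pr_crowded R _ (F v) H' p p01 FH (100 * L).
  have e1 : expR (- (p * #|F v|%:R)) <= (r%:R ^+ 10)^-1.
    by rewrite r10 ler_expR; lra.
  (* The exponent is at most 20 L - 50 L, below the required -10 L. *)
  have e2 : expR (p * #|F v|%:R - 100 * L / 2) <= (r%:R ^+ 10)^-1.
    by rewrite r10 ler_expR; lra.
  have union : Pr (pick_in R _ H' p) (A v) <=
      Pr (pick_in R _ H' p) [pred S | F v :&: S == set0] +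
      Pr (pick_in R _ H' p) [pred S : {set {set V}} | 100 * L < #|F v :&: S|%:R].
    rewrite /Pr (bigID [pred S | F v :&: S == set0]) /=; apply: lerD.
      apply: (Pr_le _ _ _ (fun S => A v S && (F v :&: S == set0))) => [|S].
        exact: pick_in01.
      by case/andP.
    apply: (Pr_le _ _ _ (fun S => A v S && (F v :&: S != set0))) => [|S].
      exact: pick_in01.
    by rewrite /A; case: eqP; rewrite ?andbF ?andbT.
  lra.
(* Here 4nq <= 1 reads 16Dr <= r^10, which follows from 16Dr <= 48 r^2 <= 2^8 r^2. *)
- have r10 : 0 < r%:R ^+ 10 :> R by rewrite exprn_gt0.
  rewrite !mulrA ler_pdivrMr // mul1r -[4]/(4%:R) -!natrM -natrX ler_nat.
  apply: leq_trans (_ : 48 * r ^ 2 <= _)%N.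
    rewrite -muln2 expnS expn1.
    have := leq_mul Dr (leqnn r); nia.
  rewrite [X in (_ <= X)%N](expnD r 8 2) leq_mul2r; apply/orP; right.
  by apply: leq_trans (_ : 2 ^ 8 <= _)%N; rewrite // leq_exp2r.
(* An edge outside [H'] has probability 0 and would make the weight of [S] vanish. *)
have SH' : S \subset H'.
  apply/subsetP => e eS; apply: contraR wS => eH.
  by rewrite /weight (bigD1 e) //= eS /pick_in (negbTE eH) mul0r.
exists S; split=> [|v]; first exact: subset_trans sH.
have -> : deg S v = #|F v :&: S|.
  apply: eq_card => e; rewrite !inE.
  by case: (boolP (e \in S)) => [/(subsetP SH')->|]; rewrite ?andbT ?andbF.
by have := AS v; rewrite negb_or -leNgt -card_gt0 => /andP[].
Qed.

Theorem theorem1p2 (R : realType) (r : nat) (hr : (2 <= r)%N) :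
  (forall (V : finType) (H : hypergraph V),
     nonempty H -> regular H -> uniform r H ->
     exists C : hypergraph V,
       spanning_subhypergraph C H /\
       forall v : V, (1 <= deg C v)%N /\ (deg C v)%:R <= 100 * ln (r%:R : R))
  /\
  (exists t : nat, is_f r t /\ t%:R <= 100 * ln (r%:R : R)).
Proof.
have main V H := log_degree_subhypergraph R r V H hr.
split=> //.
have L0 : 0 <= 100 * ln (r%:R : R) by rewrite mulr_ge0 // ln_ge0 // ler1n ltnW.
(* Degrees are integers, so the real bound may be replaced by its integer part. *)
have bound : degree_bound r (Num.trunc (100 * ln (r%:R : R))).
  move=> V H nH rH uH; have [C [CH degC]] := main V H nH rH uH.
  exists C; split=> // v; have [-> le] := degC v.
  by rewrite truncn_ge_nat.
(* [degree_bound] is a proposition; it is made boolean classically so that a least bound can be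
   extracted. *)
have ex : exists t, boolp.asbool (degree_bound r t).
  by exists (Num.trunc (100 * ln (r%:R : R))); apply/boolp.asboolP.
case: (ex_minnP ex) => t /boolp.asboolP bt mint.
exists t; split; first by split=> // s bs; apply: mint; apply/boolp.asboolP.
by rewrite -truncn_ge_nat //; apply: mint; apply/boolp.asboolP.
Qed.
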